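(* Let $\mathcal{R}$ be a commutative ring with identity with $\frac12\in\mathcal{R}$, and let $\mathcal{G}=\begin{bmatrix} A & M\\ N & B\end{bmatrix}$ and $\mathcal{G}'=\begin{bmatrix} A' & M'\\ N' & B'\end{bmatrix}$ be generalized matrix algebras over $\mathcal{R}$ such that $M$ is faithful as a left $A$-module and as a right $B$-module, and $M'$ is faithful as a left $A'$-module and as a right $B'$-module. Let $\mathfrak{l}\colon\mathcal{G}\to\mathcal{G}'$ be a Lie isomorphism. Suppose that (1) every commuting $\mathcal{R}$-linear mapping on $A'$ or $B'$ is proper (that is, every commuting linear mapping $A'\to A'$ and every commuting linear mapping $B'\to B'$ is proper); (2) $\pi_{A'}(\mathcal{Z}(\mathcal{G}'))=\mathcal{Z}(A')\neq A'$ and $\pi_{B'}(\mathcal{Z}(\mathcal{G}'))=\mathcal{Z}(B')\neq B'$; (3) either $A$ or $B$ is noncommutative; (4) $M'$ is a loyal $(A',B')$-bimodule. Then $\mathfrak{l}=\mathfrak{m}+\mathfrak{n}$, where $\mathfrak{m}\colon\mathcal{G}\to\mathcal{G}'$ is a homomorphism or the negative of an anti-homomorphism, $\mathfrak{m}$ is injective, and $\mathfrak{n}\colon\mathcal{G}\to\mathcal{Z}(\mathcal{G}')$ is an $\mathcal{R}$-linear mapping vanishing on each commutator. Moreover, if $\mathcal{G}'$ is central over $\mathcal{R}$, then $\mathfrak{m}$ is surjective.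
   Context: All algebras are associative and unital over $\mathcal{R}$; $\mathcal{Z}(\cdot)$ denotes the center and $[x,y]=xy-yx$. A Morita context $(A,B,M,N,\Phi_{MN},\Psi_{NM})$ consists of $\mathcal{R}$-algebras $A,B$, bimodules ${}_AM_B$, ${}_BN_A$, and bimodule homomorphisms $\Phi_{MN}\colon M\otimes_B N\to A$, $\Psi_{NM}\colon N\otimes_A M\to B$ (written as products $mn\in A$, $nm\in B$) satisfying $(mn)m'=m(nm')$ and $(nm)n'=n(mn')$. The set of matrices $\begin{bmatrix} a & m\\ n & b\end{bmatrix}$ with $a\in A,m\in M,n\in N,b\in B$ is then an $\mathcal{R}$-algebra under matrix addition and multiplication, called a generalized matrix algebra; at least one of $M,N$ is assumed nonzero. The projections $\pi_A,\pi_B$ send $\begin{bmatrix} a & m\\ n & b\end{bmatrix}$ to $a$ and $b$ respectively (similarly $\pi_{A'},\pi_{B'}$ on $\mathcal{G}'$). An $(A,B)$-bimodule $M$ is loyal if, for $a\in A$, $b\in B$, $aMb=0$ implies $a=0$ or $b=0$. A linear mapping $f\colon\mathcal{A}\to\mathcal{A}$ is commuting if $[f(a),a]=0$ for all $a$; it is proper if $f(a)=za+\eta(a)$ for all $a$, with $z\in\mathcal{Z}(\mathcal{A})$ and $\eta\colon\mathcal{A}\to\mathcal{Z}(\mathcal{A})$ $\mathcal{R}$-linear. A Lie isomorphism is an $\mathcal{R}$-linear bijection $\mathfrak{l}$ with $\mathfrak{l}([x,y])=[\mathfrak{l}(x),\mathfrak{l}(y)]$ for all $x,y$. Homomorphisms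 and anti-homomorphisms are $\mathcal{R}$-linear and multiplicative, resp. anti-multiplicative. An $\mathcal{R}$-algebra $\mathcal{A}$ is central over $\mathcal{R}$ if $\mathcal{Z}(\mathcal{A})=\mathcal{R}1$. *)

(* Defs.v *)
From HB Require Import structures.
From mathcomp Require Import all_boot all_order all_algebra.
From mathcomp Require Import boolp classical_sets.

Set Implicit Arguments.
Unset Strict Implicit.
Unset Printing Implicit Defensive.

Import GRing.Theory.

Local Open Scope ring_scope.
Local Open Scope classical_set_scope.

(* As both actions are R-bilinear, the two R-module structures that the       *)
(* carrier inherits from A and from B agree with the given one.               *)
Record bimodType (R : comNzRingType) (A B : algType R) := BimodType {
  bimod_sort :> lmodType R;
  lact : {bilinear A -> bimod_sort -> bimod_sort};
  ract : {bilinear bimod_sort -> B -> bimod_sort};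
  lact1 : forall m, lact 1 m = m;
  ract1 : forall m, ract m 1 = m;
  lactA : forall a a' m, lact a (lact a' m) = lact (a * a') m;
  ractA : forall m b b', ract (ract m b) b' = ract m (b * b');
  lractA : forall a m b, ract (lact a m) b = lact a (ract m b)
}.

Arguments BimodType {R A B}.
Arguments lact {R A B} _.
Arguments ract {R A B} _.

Section BimoduleProperties.
Variables (R : comNzRingType) (A B : algType R) (M : bimodType A B).

Definition left_faithful : Prop :=
  forall a : A, (forall m, lact M a m = 0) -> a = 0.

Definition right_faithful : Prop :=
  forall b : B, (forall m, ract M m b = 0) -> b = 0.

Definition loyal : Prop :=
  forall (a : A) (b : B),
    (forall m, ract M (lact M a m) b = 0) -> a = 0 \/ b = 0.

End BimoduleProperties.

(* By the universal property of the tensor product, a bimodule homomorphism   *)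
(* M (x)_B N -> A is the same as a B-balanced R-bilinear map M x N -> A that  *)
(* is A-linear on both sides.                                                 *)
Record moritaContext (R : comNzRingType) := MoritaContext {
  mcA : algType R;
  mcB : algType R;
  mcM : bimodType mcA mcB;
  mcN : bimodType mcB mcA;
  mcPhi : {bilinear mcM -> mcN -> mcA};
  mcPsi : {bilinear mcN -> mcM -> mcB};
  mcPhi_bal : forall m b n, mcPhi (ract mcM m b) n = mcPhi m (lact mcN b n);
  mcPhi_l : forall a m n, mcPhi (lact mcM a m) n = a * mcPhi m n;
  mcPhi_r : forall m n a, mcPhi m (ract mcN n a) = mcPhi m n * a;
  mcPsi_bal : forall n a m, mcPsi (ract mcN n a) m = mcPsi n (lact mcM a m);
  mcPsi_l : forall b n m, mcPsi (lact mcN b n) m = b * mcPsi n m;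
  mcPsi_r : forall n m b, mcPsi n (ract mcM m b) = mcPsi n m * b;
  mcPhiA : forall m n m', lact mcM (mcPhi m n) m' = ract mcM m (mcPsi n m');
  mcPsiA : forall n m n', lact mcN (mcPsi n m) n' = ract mcN n (mcPhi m n')
}.

(* The pair of rows ((a, m), (n, b)) stands for the 2 x 2 matrix with rows    *)
(* (a, m) and (n, b); the R-module structure is that of the product.          *)
Definition gma (R : comNzRingType) (C : moritaContext R) : Type :=
  ((mcA C * mcM C) * (mcN C * mcB C))%type.

Section GeneralizedMatrixAlgebra.
Variables (R : comNzRingType) (C : moritaContext R).

HB.instance Definition _ := GRing.Lmodule.on (gma C).

Implicit Types x y z : gma C.

Definition piA x : mcA C := x.1.1.
Definition gmaM x : mcM C := x.1.2.
Definition gmaN x : mcN C := x.2.1.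
Definition piB x : mcB C := x.2.2.

Definition gma_one : gma C := ((1, 0), (0, 1)).

Definition gma_mul x y : gma C :=
  ((piA x * piA y + mcPhi C (gmaM x) (gmaN y),
    lact (mcM C) (piA x) (gmaM y) + ract (mcM C) (gmaM x) (piB y)),
   (ract (mcN C) (gmaN x) (piA y) + lact (mcN C) (piB x) (gmaN y),
    mcPsi C (gmaN x) (gmaM y) + piB x * piB y)).

Fact gma_mulA : associative gma_mul.
Proof.
move=> [[a m] [n b]] [[a' m'] [n' b']] [[a'' m''] [n'' b'']].
rewrite /gma_mul /piA /piB /gmaM /gmaN /=.
rewrite !(linearDr, linearDl) /= !(mulrDr, mulrDl).
rewrite !(lactA, ractA, lractA, mcPhi_bal, mcPhi_l, mcPhi_r, mcPsi_bal,
  mcPsi_l, mcPsi_r, mcPhiA, mcPsiA, mulrA).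
by congr ((_, _), (_, _)); rewrite addrACA.
Qed.

Fact gma_mul1x : left_id gma_one gma_mul.
Proof.
move=> [[a m] [n b]]; rewrite /gma_mul /piA /piB /gmaM /gmaN /=.
by rewrite !(linear0l, linear0r, mul1r, lact1, ract1, addr0, add0r).
Qed.

Fact gma_mulx1 : right_id gma_one gma_mul.
Proof.
move=> [[a m] [n b]]; rewrite /gma_mul /piA /piB /gmaM /gmaN /=.
by rewrite !(linear0l, linear0r, mulr1, lact1, ract1, addr0, add0r).
Qed.

Fact gma_mulDl : left_distributive gma_mul +%R.
Proof.
move=> [[a m] [n b]] [[a' m'] [n' b']] [[a'' m''] [n'' b'']].
rewrite /gma_mul /piA /piB /gmaM /gmaN /=.
by rewrite !linearDl !mulrDl; congr ((_, _), (_, _)); rewrite addrACA.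
Qed.

Fact gma_mulDr : right_distributive gma_mul +%R.
Proof.
move=> [[a m] [n b]] [[a' m'] [n' b']] [[a'' m''] [n'' b'']].
rewrite /gma_mul /piA /piB /gmaM /gmaN /=.
by rewrite !linearDr /= !mulrDr; congr ((_, _), (_, _)); rewrite addrACA.
Qed.

Fact gma_oner_neq0 : gma_one != 0.
Proof. by apply/eqP => /(congr1 piA) /eqP; rewrite /piA /= oner_eq0. Qed.

HB.instance Definition _ := GRing.Zmodule_isNzRing.Build (gma C)
  gma_mulA gma_mul1x gma_mulx1 gma_mulDl gma_mulDr gma_oner_neq0.

Fact gma_scalerAl (k : R) x y : k *: (x * y) = k *: x * y.
Proof.
case: x y => [[a m] [n b]] [[a' m'] [n' b']].
rewrite /GRing.mul /= /gma_mul /piA /piB /gmaM /gmaN /=.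
by rewrite !linearZl_LR /= -!scalerAl -!scalerDr.
Qed.

Fact gma_scalerAr (k : R) x y : k *: (x * y) = x * (k *: y).
Proof.
case: x y => [[a m] [n b]] [[a' m'] [n' b']].
rewrite /GRing.mul /= /gma_mul /piA /piB /gmaM /gmaN /=.
by rewrite !linearZr_LR /= -!scalerAr -!scalerDr.
Qed.

HB.instance Definition _ :=
  GRing.Lmodule_isLalgebra.Build R (gma C) gma_scalerAl.
HB.instance Definition _ :=
  GRing.Lalgebra_isAlgebra.Build R (gma C) gma_scalerAr.

End GeneralizedMatrixAlgebra.

(* An algType is by definition a nonzero ring. This excludes nothing here: if *)
(* A or B were zero, then so would be M and N, both actions being unital.     *)
Definition nonzero_bimodules (R : comNzRingType) (C : moritaContext R) : Prop :=
  (exists m : mcM C, m != 0) \/ (exists n : mcN C, n != 0).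

Definition lie_bracket (A : pzRingType) (x y : A) : A := x * y - y * x.

Definition alg_center (R : pzRingType) (A : algType R) : set A :=
  [set x | forall y, x * y = y * x].

Arguments alg_center {R} A _.

Definition central_algebra (R : comNzRingType) (A : algType R) : Prop :=
  alg_center A = range (fun k : R => k%:A : A).

Definition commuting (A : pzRingType) (f : A -> A) : Prop :=
  forall a, lie_bracket (f a) a = 0.

Definition proper_map (R : comNzRingType) (A : algType R) (f : A -> A) : Prop :=
  exists (z : A) (eta : {linear A -> A}),
    [/\ alg_center A z,
        forall a, alg_center A (eta a)
      & forall a, f a = z * a + eta a].

Definition lie_isomorphism (R : comNzRingType) (A A' : algType R)
    (f : {linear A -> A'}) : Prop :=
  bijective f /\
  forall x y, f (lie_bracket x y) = lie_bracket (f x) (f y).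

(* Neither homomorphisms nor anti-homomorphisms are required to preserve 1.   *)
Definition homomorphism (R : comNzRingType) (A A' : algType R)
    (f : {linear A -> A'}) : Prop :=
  forall x y, f (x * y) = f x * f y.

Definition antihomomorphism (R : comNzRingType) (A A' : algType R)
    (f : {linear A -> A'}) : Prop :=
  forall x y, f (x * y) = f y * f x.

Definition neg_antihomomorphism (R : comNzRingType) (A A' : algType R)
    (f : {linear A -> A'}) : Prop :=
  exists g : {linear A -> A'}, antihomomorphism g /\ forall x, f x = - g x.

(* Main.v *)
Require Import Defs.
From HB Require Import structures.
From mathcomp Require Import all_boot all_order all_algebra.
From mathcomp Require Import boolp classical_sets.

Set Implicit Arguments.
Unset Strict Implicit.
Unset Printing Implicit Defensive.

Import GRing.Theory.

Local Open Scope ring_scope.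
Local Open Scope classical_set_scope.

(* Transport squaring along the Lie isomorphism: q(y) = l(l^-1(y)^2) is the   *)
(* trace of a symmetric bilinear map and commutes with y.  Testing the        *)
(* linearized identity [Q(x,y),z] + [Q(y,z),x] + [Q(z,x),y] = 0 against the   *)
(* idempotent e gives the off-diagonal entries of Q(x,y) in terms of Q(x,e)   *)
(* and Q(y,e); with loyalty and noncommutativity of the two corners it        *)
(* follows that q(y) = lam y^2 + mu(y) y + nu(y) with lam, mu, nu central.    *)
(* Thus l(x o y) = lam (l x o l y) + mu(l x) l y + mu(l y) l x + central for  *)
(* the Jordan product o, and since (x o y) o z - x o (y o z) = [y,[x,z]] is   *)
(* preserved by l one gets lam^2 = 1, hence lam = 1 or lam = -1.  Then        *)
(* m = l + lam mu(l)/2 is multiplicative (lam = 1), respectively minus it is  *)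
(* antimultiplicative (lam = -1), up to a central cocycle, which vanishes by  *)
(* associativity.                                                             *)

(** The point is that the bracket of a loyal generalized matrix algebra nearly determines its
    product. Let Q be the Jordan product x y + y x carried to G' through [l]. It inherits the
    polarized form of [x^2, x] = 0, and [commuting_trace] deduces that Q(x,y) = lam (x y + y x) +
    kap(x) y + kap(y) x modulo the center. The idempotent e = [inA 1] reduces this to S(x) = Q(x,e):
    properness of commuting maps on the corners governs its diagonal entries, and its off-diagonal
    entries are those of x times one central element. After subtraction of the standard form, the
    off-diagonal entries depend on a single central coefficient, which is zero by [trace_coef_eq0];
    what is left is diagonal, and central by [diagonal_trace_center].

    Loyalty enters through one trick ([swap_eq0_A], [swap_eq0_B]): if two elements of M can be
    exchanged in an identity, its coefficient annihilates M times a nonzero commutator of the other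
    corner. Both corners of G' have such commutators, since neither equals its center.

    Double brackets are Jordan associators, so comparing them on both sides yields lam^2 = 1
    ([lie_jordan_coef]), and lam = 1 or lam = -1 because the center is a domain ([center_domain]).
    Adding the Lie and Jordan identities and halving gives l(x y); a central shift of [l] absorbs
    the linear terms, and the remaining central defect is a cocycle, zero by [central_cocycle_eq0].
    The kernel of [m] is an ideal inside the center, hence zero by faithfulness. If G' is central
    over R, then the scalars lie in the image of [m], and with them everything. *)

(* Reflexive decision of identities that hold in every abelian group.         *)
Inductive zexpr := ZVar of nat | ZZero | ZAdd of zexpr & zexpr | ZOpp of zexpr.

Fixpoint zeval (V : zmodType) (env : seq V) (e : zexpr) : V :=
  match e with
  | ZVar n => env`_n
  | ZZero => 0
  | ZAdd e1 e2 => zeval env e1 + zeval env e2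
  | ZOpp e1 => - zeval env e1
  end.

Fixpoint zcoef (e : zexpr) (i : nat) : int :=
  match e with
  | ZVar n => if n == i then 1 else 0
  | ZZero => 0
  | ZAdd e1 e2 => zcoef e1 i + zcoef e2 i
  | ZOpp e1 => - zcoef e1 i
  end.

(** The normal form in a free abelian group. An index beyond [env] evaluates to the default 0, so
    its coefficient may be ignored. *)
Lemma zevalE (V : zmodType) (env : seq V) e :
  zeval env e = \sum_(i < size env) env`_i *~ zcoef e i.
Proof.
elim: e => [n||e1 IH1 e2 IH2|e IH] /=.
- case: (ltnP n (size env)) => [lt_n|ge_n].
    rewrite (bigD1 (Ordinal lt_n)) //= eqxx mulr1z big1 ?addr0 // => i ne_i.
    case: eqP => [e_ni|]; last by rewrite mulr0z.
    by case/eqP: ne_i; apply: val_inj.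
  rewrite nth_default // big1 // => i _.
  case: eqP => [e_ni|]; last by rewrite mulr0z.
  by have := ltn_ord i; rewrite -e_ni ltnNge ge_n.
- by rewrite big1 // => i _; rewrite mulr0z.
- by rewrite IH1 IH2 -big_split; apply: eq_bigr => i _; rewrite mulrzDr.
- by rewrite IH -sumrN; apply: eq_bigr => i _; rewrite mulrNz.
Qed.

Lemma zeval_eq (V : zmodType) (env : seq V) e1 e2 :
  all (fun i => zcoef e1 i == zcoef e2 i) (iota 0 (size env)) ->
  zeval env e1 = zeval env e2.
Proof.
move=> /allP eq12; rewrite !zevalE; apply: eq_bigr => i _.
have /eqP-> // : zcoef e1 i == zcoef e2 i.
by apply: eq12; rewrite mem_iota /=.
Qed.

(* Ring operations are compared up to their canonical structure arguments,    *)
(* which may be spelled in several convertible ways.                          *)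
Ltac zsame x y :=
  first
  [ constr_eq x y
  | lazymatch x with
    | GRing.mul ?a ?b =>
      lazymatch y with GRing.mul ?c ?d => zsame a c; zsame b d end
    | GRing.scale ?a ?b =>
      lazymatch y with GRing.scale ?c ?d => zsame a c; zsame b d end
    | GRing.Linear.sort ?f ?a =>
      lazymatch y with GRing.Linear.sort ?g ?b => zsame f g; zsame a b end
    | lie_bracket ?a ?b =>
      lazymatch y with lie_bracket ?c ?d => zsame a c; zsame b d end
    | GRing.add ?a ?b =>
      lazymatch y with GRing.add ?c ?d => zsame a c; zsame b d end
    | GRing.opp ?a => lazymatch y with GRing.opp ?c => zsame a c end
    | @GRing.one _ => lazymatch y with @GRing.one _ => idtac end
    | @GRing.zero _ => lazymatch y with @GRing.zero _ => idtac end
    | ?f ?a => lazymatch y with ?g ?b => zsame f g; zsame a b end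
    end ].
Ltac zindex x env :=
  match env with
  | ?y :: _ => let _ := match goal with _ => zsame x y end in constr:(0%N)
  | _ :: ?env' => let n := zindex x env' in constr:(S n)
  end.
Ltac zatoms t env :=
  lazymatch t with
  | GRing.add ?a ?b => let env' := zatoms a env in zatoms b env'
  | GRing.opp ?a => zatoms a env
  | @GRing.zero _ => env
  | _ => match env with
         | _ => let n := zindex t env in env
         | _ => constr:(t :: env)
         end
  end.
Ltac zreify t env :=
  lazymatch t with
  | GRing.add ?a ?b =>
      let ea := zreify a env in let eb := zreify b env in constr:(ZAdd ea eb)
  | GRing.opp ?a => let ea := zreify a env in constr:(ZOpp ea)
  | @GRing.zero _ => constr:(ZZero)
  | _ => let n := zindex t env in constr:(ZVar n)
  end.
(** Products, brackets and values of maps count as atoms here, so distributivity and centrality have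
    to be applied beforehand. *)
Ltac zmod :=
  lazymatch goal with
  | |- @eq ?T ?x ?y =>
    let env1 := zatoms x (@nil T) in
    let env := zatoms y env1 in
    let ex := zreify x env in
    let ey := zreify y env in
    apply: (@zeval_eq _ env ex ey); vm_compute; reflexivity
  end.

(** * Lie and Jordan products, and the center of an algebra *)

Lemma linear_pack (R : pzRingType) (U V : lmodType R) (f : U -> V) :
  (forall k x y, f (k *: x + y) = k *: f x + f y) ->
  exists g : {linear U -> V}, forall x, g x = f x.
Proof.
move=> f_lin; pose F := GRing.isLinear.Build R U V _ f f_lin.
pose g : {linear U -> V} := HB.pack f F.
by exists g.
Qed.

Lemma bracketx0 (D : pzRingType) (x : D) : lie_bracket x 0 = 0.
Proof. by rewrite /lie_bracket mulr0 mul0r subrr. Qed.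

Lemma bracketx1 (D : pzRingType) (x : D) : lie_bracket x 1 = 0.
Proof. by rewrite /lie_bracket mulr1 mul1r subrr. Qed.

Lemma bracket0P (D : pzRingType) (x y : D) :
  lie_bracket x y = 0 <-> x * y = y * x.
Proof.
by split=> [/eqP|e]; rewrite /lie_bracket ?e ?subrr // subr_eq0 => /eqP.
Qed.

Lemma lie_bracketC (D : pzRingType) (x y : D) :
  lie_bracket x y = - lie_bracket y x.
Proof. by rewrite /lie_bracket opprB. Qed.

Lemma bracketDl (D : pzRingType) (x y z : D) :
  lie_bracket (x + y) z = lie_bracket x z + lie_bracket y z.
Proof. by rewrite /lie_bracket mulrDl mulrDr; zmod. Qed.

Lemma bracketNl (D : pzRingType) (x z : D) :
  lie_bracket (- x) z = - lie_bracket x z.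
Proof. by rewrite /lie_bracket mulNr mulrN; zmod. Qed.

(** The polarization of [x^2, x] = 0. *)
Lemma jordan_cyc (A : nzRingType) (x y z : A) :
  lie_bracket (x * y + y * x) z + lie_bracket (y * z + z * y) x
  + lie_bracket (z * x + x * z) y = 0.
Proof. rewrite /lie_bracket !(mulrDl, mulrDr) !mulrA.  zmod. Qed.

Definition jor (D : pzRingType) (x y : D) := x * y + y * x.

Lemma jorDl (D : pzRingType) (x y z : D) : jor (x + y) z = jor x z + jor y z.
Proof. by rewrite /jor mulrDl mulrDr; zmod. Qed.

Lemma jorC (D : pzRingType) (x y : D) : jor x y = jor y x.
Proof. by rewrite /jor addrC. Qed.

(** The associator of the Jordan product is a double Lie bracket, so a Lie isomorphism preserves
    it. *)
Lemma jor_associator (D : pzRingType) (x y z : D) :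
  jor (jor x y) z - jor (jor y z) x = lie_bracket y (lie_bracket x z).
Proof. by rewrite /lie_bracket /jor !(mulrDl, mulrDr, mulrN, mulNr) !mulrA; zmod. Qed.

Section Center.
Variables (R : pzRingType) (A : algType R).
Implicit Types x y z : A.

Lemma center0 : alg_center A 0.
Proof. by move=> y; rewrite mul0r mulr0. Qed.

Lemma center1 : alg_center A 1.
Proof. by move=> y; rewrite mul1r mulr1. Qed.

Lemma centerD x y : alg_center A x -> alg_center A y -> alg_center A (x + y).
Proof. by move=> cx cy z; rewrite mulrDl mulrDr cx cy. Qed.

Lemma centerN x : alg_center A x -> alg_center A (- x).
Proof. by move=> cx z; rewrite mulNr mulrN cx. Qed.

Lemma centerB x y : alg_center A x -> alg_center A y -> alg_center A (x - y).
Proof. by move=> cx cy; apply/centerD/centerN. Qed.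

Lemma centerM x y : alg_center A x -> alg_center A y -> alg_center A (x * y).
Proof. by move=> cx cy z; rewrite -mulrA cy mulrA cx mulrA. Qed.

Lemma centerZ (k : R) x : alg_center A x -> alg_center A (k *: x).
Proof. by move=> cx z; rewrite -scalerAl -scalerAr cx. Qed.

Lemma centerP x : alg_center A x <-> forall y, lie_bracket x y = 0.
Proof. by split=> h y; apply/bracket0P/h. Qed.

Lemma bracketMl c x y : alg_center A c ->
  lie_bracket (c * x) y = c * lie_bracket x y.
Proof. by move=> cc; rewrite /lie_bracket mulrBr !mulrA -(cc y). Qed.

Lemma jorMl c x y : alg_center A c ->
  jor (c * x) y = c * jor x y.
Proof. by move=> cc; rewrite /jor mulrDr !mulrA -(cc y). Qed.

Lemma jor_center c y : alg_center A c ->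
  jor c y = c * y + c * y.
Proof. by move=> cc; rewrite /jor -cc. Qed.

End Center.

(** * Peirce components *)

Section Peirce.
Variables (R : comNzRingType) (C : moritaContext R).
Notation G := (gma C).
Notation A := (mcA C).
Notation B := (mcB C).
Notation M := (mcM C).
Notation N := (mcN C).
Implicit Types (x y z u v w : G) (a : A) (b : B) (m : M) (n : N).

Definition inA a : G := ((a, 0), (0, 0)).
Definition inM m : G := ((0, m), (0, 0)).
Definition inN n : G := ((0, 0), (n, 0)).
Definition inB b : G := ((0, 0), (0, b)).

Lemma piA_mul x y : piA (x * y) = piA x * piA y + mcPhi C (gmaM x) (gmaN y).
Proof. by []. Qed.
Lemma gmaM_mul x y :
  gmaM (x * y) = lact M (piA x) (gmaM y) + ract M (gmaM x) (piB y).
Proof. by []. Qed.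
Lemma gmaN_mul x y :
  gmaN (x * y) = ract N (gmaN x) (piA y) + lact N (piB x) (gmaN y).
Proof. by []. Qed.
Lemma piB_mul x y : piB (x * y) = mcPsi C (gmaN x) (gmaM y) + piB x * piB y.
Proof. by []. Qed.
Definition gma_mulE := (piA_mul, gmaM_mul, gmaN_mul, piB_mul).

Definition gma_linE :=
  ((erefl : piA (0 : G) = 0), (erefl : gmaM (0 : G) = 0),
   (erefl : gmaN (0 : G) = 0), (erefl : piB (0 : G) = 0),
   (fun x y => erefl : piA (x + y) = piA x + piA y),
   (fun x y => erefl : gmaM (x + y) = gmaM x + gmaM y),
   (fun x y => erefl : gmaN (x + y) = gmaN x + gmaN y),
   (fun x y => erefl : piB (x + y) = piB x + piB y),
   (fun x => erefl : piA (- x) = - piA x),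
   (fun x => erefl : gmaM (- x) = - gmaM x),
   (fun x => erefl : gmaN (- x) = - gmaN x),
   (fun x => erefl : piB (- x) = - piB x),
   (fun k x => erefl : piA (k *: x) = k *: piA x),
   (fun k x => erefl : gmaM (k *: x) = k *: gmaM x),
   (fun k x => erefl : gmaN (k *: x) = k *: gmaN x),
   (fun k x => erefl : piB (k *: x) = k *: piB x)).

Lemma gma_eq x y : piA x = piA y -> gmaM x = gmaM y -> gmaN x = gmaN y ->
  piB x = piB y -> x = y.
Proof.
case: x y => [[a m] [n b]] [[a' m'] [n' b']].
by rewrite /piA /piB /gmaM /gmaN /= => -> -> -> ->.
Qed.

Definition entryE :=
  ((fun a => erefl : piA (inA a) = a), (fun a => erefl : gmaM (inA a) = 0),
   (fun a => erefl : gmaN (inA a) = 0), (fun a => erefl : piB (inA a) = 0),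
   (fun m => erefl : piA (inM m) = 0), (fun m => erefl : gmaM (inM m) = m),
   (fun m => erefl : gmaN (inM m) = 0), (fun m => erefl : piB (inM m) = 0),
   (fun n => erefl : piA (inN n) = 0), (fun n => erefl : gmaM (inN n) = 0),
   (fun n => erefl : gmaN (inN n) = n), (fun n => erefl : piB (inN n) = 0),
   (fun b => erefl : piA (inB b) = 0), (fun b => erefl : gmaM (inB b) = 0),
   (fun b => erefl : gmaN (inB b) = 0), (fun b => erefl : piB (inB b) = b)).

Definition act0 :=
  ((fun n => linear0l (mcPhi C) n : mcPhi C 0 n = 0),
   (fun m => linear0r (mcPhi C) m : mcPhi C m 0 = 0),
   (fun m => linear0l (mcPsi C) m : mcPsi C 0 m = 0),
   (fun n => linear0r (mcPsi C) n : mcPsi C n 0 = 0),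
   (fun m => linear0l (lact M) m : lact M 0 m = 0),
   (fun a => linear0r (lact M) a : lact M a 0 = 0),
   (fun b => linear0l (ract M) b : ract M 0 b = 0),
   (fun m => linear0r (ract M) m : ract M m 0 = 0),
   (fun n => linear0l (lact N) n : lact N 0 n = 0),
   (fun b => linear0r (lact N) b : lact N b 0 = 0),
   (fun a => linear0l (ract N) a : ract N 0 a = 0),
   (fun n => linear0r (ract N) n : ract N n 0 = 0)).

Definition actE :=
  ((fun m a a' => linearDl (lact M) m a a' :
     lact M (a + a') m = lact M a m + lact M a' m),
   (fun a m m' => linearDr (lact M) a m m' :
     lact M a (m + m') = lact M a m + lact M a m'),
   (fun b m m' => linearDl (ract M) b m m' :
     ract M (m + m') b = ract M m b + ract M m' b),
   (fun m b b' => linearDr (ract M) m b b' :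
     ract M m (b + b') = ract M m b + ract M m b'),
   (fun n b b' => linearDl (lact N) n b b' :
     lact N (b + b') n = lact N b n + lact N b' n),
   (fun b n n' => linearDr (lact N) b n n' :
     lact N b (n + n') = lact N b n + lact N b n'),
   (fun a n n' => linearDl (ract N) a n n' :
     ract N (n + n') a = ract N n a + ract N n' a),
   (fun n a a' => linearDr (ract N) n a a' :
     ract N n (a + a') = ract N n a + ract N n a'),
   (fun m a => linearNl (lact M) m a : lact M (- a) m = - lact M a m),
   (fun a m => linearNr (lact M) a m : lact M a (- m) = - lact M a m),
   (fun b m => linearNl (ract M) b m : ract M (- m) b = - ract M m b),
   (fun m b => linearNr (ract M) m b : ract M m (- b) = - ract M m b),
   (fun n b => linearNl (lact N) n b : lact N (- b) n = - lact N b n),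
   (fun b n => linearNr (lact N) b n : lact N b (- n) = - lact N b n),
   (fun a n => linearNl (ract N) a n : ract N (- n) a = - ract N n a),
   (fun n a => linearNr (ract N) n a : ract N n (- a) = - ract N n a)).

Definition actZ :=
  ((fun k m a => linearZl_LR (lact M) m k a :
     lact M (k *: a) m = k *: lact M a m),
   (fun k a m => linearZr_LR (lact M) a k m :
     lact M a (k *: m) = k *: lact M a m),
   (fun k b m => linearZl_LR (ract M) b k m :
     ract M (k *: m) b = k *: ract M m b),
   (fun k m b => linearZr_LR (ract M) m k b :
     ract M m (k *: b) = k *: ract M m b),
   (fun k n b => linearZl_LR (lact N) n k b :
     lact N (k *: b) n = k *: lact N b n),
   (fun k b n => linearZr_LR (lact N) b k n :
     lact N b (k *: n) = k *: lact N b n),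
   (fun k a n => linearZl_LR (ract N) a k n :
     ract N (k *: n) a = k *: ract N n a),
   (fun k n a => linearZr_LR (ract N) n k a :
     ract N n (k *: a) = k *: ract N n a)).

(** Commuting with the idempotent [inA 1] forces the off-diagonal entries to vanish. *)
Lemma center_gmaM z : alg_center G z -> gmaM z = 0.
Proof.
move=> /(_ (inA 1)) /(congr1 (@gmaM _ _)).
by rewrite !gma_mulE !entryE !act0 lact1 !addr0.
Qed.

Lemma center_gmaN z : alg_center G z -> gmaN z = 0.
Proof.
move=> /(_ (inA 1)) /(congr1 (@gmaN _ _)).
by rewrite !gma_mulE !entryE !act0 ract1 !addr0.
Qed.

(** Commuting with [inM m] lets a central factor pass from one side of M to the other. *)
Lemma center_lactM z m : alg_center G z -> lact M (piA z) m = ract M m (piB z).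
Proof.
move=> /(_ (inM m)) /(congr1 (@gmaM _ _)).
by rewrite !gma_mulE !entryE !act0 addr0 add0r.
Qed.

Lemma center_lactN z n : alg_center G z -> lact N (piB z) n = ract N n (piA z).
Proof.
move=> /(_ (inN n)) /(congr1 (@gmaN _ _)).
by rewrite !gma_mulE !entryE !act0 addr0 add0r.
Qed.

Lemma center_piA z : alg_center G z -> alg_center A (piA z).
Proof.
move=> cz a; have := congr1 (@piA _ _) (cz (inA a)).
by rewrite !gma_mulE !entryE !act0 !addr0.
Qed.

Lemma center_piB z : alg_center G z -> alg_center B (piB z).
Proof.
move=> cz b; have := congr1 (@piB _ _) (cz (inB b)).
by rewrite !gma_mulE !entryE !act0 !add0r.
Qed.

Lemma piA_bracket x y : piA (lie_bracket x y) =
  lie_bracket (piA x) (piA y)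
  + (mcPhi C (gmaM x) (gmaN y) - mcPhi C (gmaM y) (gmaN x)).
Proof. rewrite /lie_bracket !gma_linE !gma_mulE; zmod. Qed.

Lemma piB_bracket x y : piB (lie_bracket x y) =
  lie_bracket (piB x) (piB y)
  + (mcPsi C (gmaN x) (gmaM y) - mcPsi C (gmaN y) (gmaM x)).
Proof. by rewrite /lie_bracket !gma_linE !gma_mulE; zmod. Qed.

Lemma gmaM_bracket x y : gmaM (lie_bracket x y) =
  lact M (piA x) (gmaM y) - ract M (gmaM y) (piB x)
  - (lact M (piA y) (gmaM x) - ract M (gmaM x) (piB y)).
Proof. by rewrite /lie_bracket !gma_linE !gma_mulE; zmod. Qed.

Lemma gmaN_bracket x y : gmaN (lie_bracket x y) =
  lact N (piB x) (gmaN y) - ract N (gmaN y) (piA x)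
  - (lact N (piB y) (gmaN x) - ract N (gmaN x) (piA y)).
Proof. by rewrite /lie_bracket !gma_linE !gma_mulE; zmod. Qed.

End Peirce.

(** * The center under faithfulness and loyalty *)

Section LoyalGMA.
Variables (R : comNzRingType) (C : moritaContext R).
Notation G := (gma C).
Notation A := (mcA C).
Notation B := (mcB C).
Notation M := (mcM C).
Notation N := (mcN C).
Implicit Types (x y z u v w : G) (a : A) (b : B) (m : M) (n : N).

Hypothesis faithful_l : left_faithful M.
Hypothesis faithful_r : right_faithful M.

(** On M the two diagonal entries of a central element act alike, so by faithfulness one determines
    the other. *)
Lemma center_piA_inj z z' : alg_center G z -> alg_center G z' ->
  piA z = piA z' -> z = z'.
Proof.
move=> cz cz' eA; apply: gma_eq => //.
- by rewrite !center_gmaM.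
- by rewrite !center_gmaN.
apply/eqP; rewrite -subr_eq0; apply/eqP/faithful_r => m.
by rewrite !actE -!center_lactM // eA subrr.
Qed.

Lemma center_piB_inj z z' : alg_center G z -> alg_center G z' ->
  piB z = piB z' -> z = z'.
Proof.
move=> cz cz' eB; apply: center_piA_inj => //.
apply/eqP; rewrite -subr_eq0; apply/eqP/faithful_l => m.
by rewrite !actE !center_lactM // eB subrr.
Qed.

Hypothesis center_A : @piA _ C @` alg_center G = alg_center A.

Lemma lift_piA a : alg_center A a -> exists2 z, alg_center G z & piA z = a.
Proof. by rewrite -center_A. Qed.

(** Faithfulness makes [piA x] central in A; it lifts to a central z, and z and x have the same
    B-entry because both act on M as [piA x] does. *)
Lemma diag_center x : gmaM x = 0 -> gmaN x = 0 ->
  (forall m, lact M (piA x) m = ract M m (piB x)) -> alg_center G x.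
Proof.
move=> xM xN xAB; have cA : alg_center A (piA x).
  move=> a; apply/eqP; rewrite -subr_eq0; apply/eqP/faithful_l => m.
  by rewrite !actE -!lactA /= !xAB lractA subrr.
have [z cz eA] := lift_piA cA; suff <- : z = x by [].
apply: gma_eq => //; first by rewrite xM center_gmaM.
  by rewrite xN center_gmaN.
apply/eqP; rewrite -subr_eq0; apply/eqP/faithful_r => m.
by rewrite !actE -center_lactM // eA xAB subrr.
Qed.

Hypothesis center_B : @piB _ C @` alg_center G = alg_center B.

Lemma lift_piB b : alg_center B b -> exists2 z, alg_center G z & piB z = b.
Proof. by rewrite -center_B. Qed.

Hypothesis ncA : exists a a', a * a' - a' * a != 0.
Hypothesis ncB : exists b b', b * b' - b' * b != 0.
Hypothesis loyal_M : loyal M.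

(** Passing z' across M turns z z' = 0 into [piA z] M [piB z'] = 0, to which loyalty applies. *)
Lemma center_domain z z' :
  alg_center G z -> alg_center G z' -> z * z' = 0 -> z = 0 \/ z' = 0.
Proof.
move=> cz cz' /(congr1 (@piA _ _)); rewrite piA_mul (center_gmaM cz) act0 addr0.
move=> zz'; case: (loyal_M (a := piA z) (b := piB z')) => [m||].
- by rewrite lractA -center_lactM // lactA zz' act0.
- by left; apply: center_piA_inj => //; apply: center0.
- by right; apply: center_piB_inj => //; apply: center0.
Qed.

(** For noncommuting a and a' one gets [a, a'] M [piB z] = 0, and loyalty leaves only [piB z] =
    0. *)
Lemma center_mul_commutator_eq0 z : alg_center G z ->
  (forall a a', piA z * (a * a' - a' * a) = 0) -> z = 0.
Proof.
move=> cz zaa'; have [a [a' /eqP naa']] := ncA.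
case: (loyal_M (a := a * a' - a' * a) (b := piB z)) => [m|//|zB].
  by rewrite lractA -center_lactM // lactA -(center_piA cz) zaa' act0.
by apply: center_piB_inj => //; apply: center0.
Qed.

(* Replacing m by m b shows F(m) M [b, b'] = 0.                               *)
Lemma swap_eq0_A (F F' : M -> A) :
  (forall m m', lact M (F m) m' + lact M (F' m') m = 0) -> forall m, F m = 0.
Proof.
move=> FF' m; have [b [b' /eqP nbb']] := ncB.
have Fmb c m' : lact M (F (ract M m c)) m' = ract M (lact M (F m) m') c.
  apply/eqP; rewrite -subr_eq0 -[X in X - _](addrK (lact M (F' m') (ract M m c))).
  by rewrite FF' add0r -opprD -lractA -actE addrC FF' linear0l oppr0.
case: (loyal_M (a := F m) (b := b * b' - b' * b)) => // m'.
by rewrite !actE -!ractA -Fmb lractA Fmb -lractA subrr.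
Qed.

(** The mirror image of [swap_eq0_A]: replacing m by a m gives [a, a'] M F(m) = 0. *)
Lemma swap_eq0_B (F F' : M -> B) :
  (forall m m', ract M m' (F m) + ract M m (F' m') = 0) -> forall m, F m = 0.
Proof.
move=> FF' m; have [a [a' /eqP naa']] := ncA.
have Fam c m' : ract M m' (F (lact M c m)) = lact M c (ract M m' (F m)).
  apply/eqP; rewrite -subr_eq0 -[X in X - _](addrK (ract M (lact M c m) (F' m'))).
  by rewrite FF' add0r -opprD lractA -actE addrC FF' act0 oppr0.
case: (loyal_M (a := a * a' - a' * a) (b := F m)) => // m'.
by rewrite !actE -!lactA !lractA -Fam -lractA Fam lractA subrr.
Qed.

(** * Commuting traces *)

Section DiagonalTrace.

Variable Q : G -> G -> G.
Hypothesis QD : forall x x' y, Q (x + x') y = Q x y + Q x' y.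
Hypothesis QC : forall x y, Q x y = Q y x.
Hypothesis Q_cyc : forall x y z,
  lie_bracket (Q x y) z + lie_bracket (Q y z) x + lie_bracket (Q z x) y = 0.

(* The M-entry of [x, inM m]. *)
Definition jM x m := lact M (piA x) m - ract M m (piB x).

(* The identity for x = a, y = b and M yields z [a, a'] M [b', b] = 0, to     *)
(* which loyalty applies.                                                     *)
Lemma trace_coef_eq0 z : alg_center G z ->
  (forall x y, gmaM (Q x y) =
     lact M (piA z) (ract M (gmaM x) (piB y) + ract M (gmaM y) (piB x))) ->
  z = 0.
Proof.
move=> cz QM; apply: center_mul_commutator_eq0 => // a a'.
have [b [b' /eqP nbb']] := ncB.
have QabM c m : jM (Q (inA c) (inB b)) m =
    lact M c (lact M (piA z) (ract M m b)).
  have := congr1 (@gmaM _ _) (Q_cyc (inA c) (inB b) (inM m)).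
  rewrite !gma_linE !gma_mulE !QM !entryE !(act0, addr0, add0r, subr0, oppr0).
  by move/eqP; rewrite subr_eq0 => /eqP.
have {QabM} := QabM a; rewrite /jM.
set u := piA _; set v := piB _; move: u v => u v QabM.
(* The left factor u commutes with the right action of b' and cancels. Thus m -> a z m [b', b] is a
   right multiplication, so it commutes with the left action of a'. *)
have Hv m : ract M m (v * b' - b' * v) =
    lact M a (lact M (piA z) (ract M m (b' * b - b * b'))).
  have := congr1 (fun m => ract M m b') (QabM m).
  have := QabM (ract M m b').
  rewrite !actE -!ractA -!lractA => <- <-.
  by zmod.
case: (loyal_M (a := piA z * (a * a' - a' * a)) (b := b' * b - b * b')).
- move=> m; set c := b' * b - b * b' in Hv *; clearbody c.
  rewrite (center_piA cz) mulrBl -[a * a' * _]mulrA -(center_piA cz a') !actE.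
  by rewrite -!lactA !lractA -Hv -[X in _ - X]lractA Hv !lractA subrr.
- by [].
- by move=> e; case: nbb'; rewrite -opprB e oppr0.
Qed.

Hypothesis QM : forall x y, gmaM (Q x y) = 0.
Hypothesis QN : forall x y, gmaN (Q x y) = 0.

Lemma Q_cycA x y z : lie_bracket (piA (Q x y)) (piA z) +
  lie_bracket (piA (Q y z)) (piA x) + lie_bracket (piA (Q z x)) (piA y) = 0.
Proof.
have := congr1 (@piA _ _) (Q_cyc x y z).
by rewrite !gma_linE !gma_mulE !QM !QN !act0 => <-; rewrite /lie_bracket; zmod.
Qed.

Lemma Q_cycB x y z : lie_bracket (piB (Q x y)) (piB z) +
  lie_bracket (piB (Q y z)) (piB x) + lie_bracket (piB (Q z x)) (piB y) = 0.
Proof.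
have := congr1 (@piB _ _) (Q_cyc x y z).
by rewrite !gma_linE !gma_mulE !QM !QN !act0 => <-; rewrite /lie_bracket; zmod.
Qed.

Lemma Q_cycM x y z :
  jM (Q x y) (gmaM z) + jM (Q y z) (gmaM x) + jM (Q z x) (gmaM y) = 0.
Proof.
have := congr1 (@gmaM _ _) (Q_cyc x y z).
by rewrite !gma_linE !gma_mulE !QM !act0 => <-; rewrite /jM; zmod.
Qed.

Lemma jM_center x y : (forall m, jM (Q x y) m = 0) -> alg_center G (Q x y).
Proof.
move=> j0; apply: diag_center => // m; apply/eqP.
by rewrite -subr_eq0; apply/eqP/j0.
Qed.

Lemma jM0 x : jM x 0 = 0.
Proof. by rewrite /jM !act0 subr0. Qed.

(** A choice of partner in the center of A for each central b; the value 0 elsewhere is a dummy. *)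
Lemma lift_BA : exists phi : B -> A, forall b, alg_center B b ->
  alg_center A (phi b) /\ forall m, lact M (phi b) m = ract M m b.
Proof.
suff /choice[phi] : forall b, exists a, alg_center B b ->
    alg_center A a /\ forall m, lact M a m = ract M m b by exists phi.
move=> b; case: (pselect (alg_center B b)) => [/lift_piB[z cz <-]|ncb].
  exists (piA z) => _; split; first exact: center_piA.
  by move=> m; rewrite center_lactM.
by exists 0.
Qed.

Lemma lift_AB : exists phi : A -> B, forall a, alg_center A a ->
  alg_center B (phi a) /\ forall m, ract M m (phi a) = lact M a m.
Proof.
suff /choice[phi] : forall a, exists b, alg_center A a ->
    alg_center B b /\ forall m, ract M m b = lact M a m by exists phi.
move=> a; case: (pselect (alg_center A a)) => [/lift_piA[z cz <-]|nca].
  exists (piB z) => _; split; first exact: center_piB.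
  by move=> m; rewrite center_lactM.
by exists 0.
Qed.

(** A central diagonal entry can be moved across M, which makes [jM (D m)] a one-sided
    multiplication; skew symmetry is then an exchange identity for [swap_eq0_B] or [swap_eq0_A]. *)
Lemma jM_skew_eq0 (D : M -> G) :
  (forall m, alg_center A (piA (D m))) \/ (forall m, alg_center B (piB (D m))) ->
  (forall m m', jM (D m) m' + jM (D m') m = 0) -> forall m m', jM (D m) m' = 0.
Proof.
case=> cD jD m m'.
  have [phi phiP] := lift_AB.
  pose F m := phi (piA (D m)) - piB (D m).
  have FE m1 m2 : ract M m1 (F m2) = jM (D m2) m1.
    by rewrite !actE (phiP _ (cD m2)).2.
  rewrite -FE (@swap_eq0_B F F) ?act0 // => m1 m2.
  by rewrite !FE.
have [phi phiP] := lift_BA.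
pose F m := piA (D m) - phi (piB (D m)).
have FE m1 m2 : lact M (F m1) m2 = jM (D m1) m2.
  by rewrite !actE (phiP _ (cD m1)).2.
rewrite -FE (@swap_eq0_A F F) ?act0 // => m1 m2.
by rewrite !FE.
Qed.

Lemma diagonal_trace_center_diag x y : gmaM x = 0 -> gmaM y = 0 -> alg_center G (Q x y).
Proof.
move=> xM yM; apply: jM_center => m; have := Q_cycM x y (inM m).
by rewrite xM yM !jM0 !addr0.
Qed.

Lemma diagonal_trace_center_skew x :
  (forall m, alg_center A (piA (Q x (inM m)))) \/
  (forall m, alg_center B (piB (Q x (inM m)))) ->
  gmaM x = 0 -> forall m, alg_center G (Q x (inM m)).
Proof.
move=> cQ xM m; apply: jM_center; move: m; apply: jM_skew_eq0 => // m m'.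
by have := Q_cycM x (inM m) (inM m'); rewrite xM jM0 addr0 (QC _ x).
Qed.

(** Both diagonal entries of Q(m, m') are central, so it acts on M through a symmetric F(m, m') in
    the center of A. The cyclic identity makes F left A-linear in its second argument; hence a F(m,
    m') is again central, and F(m, m') kills all commutators of A. *)
Lemma diagonal_trace_center_MM m m' : alg_center G (Q (inM m) (inM m')).
Proof.
have cA p q : alg_center A (piA (Q (inM p) (inM q))).
  apply/centerP => a; have := Q_cycA (inM p) (inM q) (inA a).
  by rewrite !entryE !bracketx0 !addr0.
have cB p q : alg_center B (piB (Q (inM p) (inM q))).
  apply/centerP => b; have := Q_cycB (inM p) (inM q) (inB b).
  by rewrite !entryE !bracketx0 !addr0.
have [phi phiP] := lift_BA.
pose F p q := piA (Q (inM p) (inM q)) - phi (piB (Q (inM p) (inM q))).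
have FE p q r : lact M (F p q) r = jM (Q (inM p) (inM q)) r.
  by rewrite !actE (phiP _ (cB p q)).2.
have cF p q : alg_center A (F p q).
  by apply: centerB => //; have [] := phiP _ (cB p q).
have F_cyc p q r : lact M (F p q) r + lact M (F q r) p + lact M (F r p) q = 0.
  by rewrite !FE; apply: (Q_cycM (inM p) (inM q) (inM r)).
have FC p q : F p q = F q p by rewrite /F QC.
clearbody F.
(* Subtract a times the identity at (p, p', q) from the one at (p, p', a q). As F(p, p') is central,
   only two defects of linearity survive, in exchange form. *)
have FM p q a : F p (lact M a q) = a * F p q.
  apply/eqP; rewrite -subr_eq0; apply/eqP; move: p.
  apply: (@swap_eq0_A _ (fun p => F p (lact M a q) - a * F p q)) => p p'.
  have e1 := F_cyc p p' (lact M a q).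
  rewrite lactA (cF p p') -lactA (FC _ p) in e1.
  have e2 := congr1 (lact M a) (F_cyc p p' q).
  rewrite (FC q p) !actE act0 in e2.
  by rewrite -[RHS]subr0 -{1}e1 -e2 !actE -!lactA; zmod.
suff F0 : F m m' = 0.
  by apply: jM_center => r; rewrite -FE F0 act0.
have [z cz zF] := lift_piA (cF m m'); suff z0 : z = 0 by rewrite -zF z0.
apply: center_mul_commutator_eq0 => // a a'.
by rewrite zF mulrBr mulrA (cF m m') -FM cF FM (cF m m' (a' * a)) mulrA subrr.
Qed.

Lemma diagonal_trace_center x y : alg_center G (Q x y).
Proof.
pose diag z := inA (piA z) + inN (gmaN z) + inB (piB z).
have decomp z : z = diag z + inM (gmaM z).
  by apply: gma_eq; rewrite !gma_linE !entryE !(addr0, add0r).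
have dM z : gmaM (diag z) = 0 by rewrite !gma_linE !entryE !addr0.
have cdM z m : alg_center G (Q (diag z) (inM m)).
  (* An element of A has no B-entry and one of N or B has no A-entry. In that corner the cyclic
     identity with M retains a single bracket, which shows this entry of Q to be central. *)
  rewrite !QD; apply: centerD; [apply: centerD|]; apply: diagonal_trace_center_skew => //.
  - right=> p; apply/centerP => b.
    have := Q_cycB (inA (piA z)) (inM p) (inB b).
    by rewrite !entryE !bracketx0 !addr0.
  - left=> p; apply/centerP => a.
    have := Q_cycA (inN (gmaN z)) (inM p) (inA a).
    by rewrite !entryE !bracketx0 !addr0.
  - left=> p; apply/centerP => a.
    have := Q_cycA (inB (piB z)) (inM p) (inA a).
    by rewrite !entryE !bracketx0 !addr0.
rewrite (decomp x) QD; apply: centerD.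
  rewrite QC (decomp y) QD; apply: centerD; first exact: diagonal_trace_center_diag.
  by rewrite QC.
rewrite QC (decomp y) QD; apply: centerD => //.
exact: diagonal_trace_center_MM.
Qed.

End DiagonalTrace.

(** * The standard form of a commuting trace *)

Section CommutingTrace.

Variable h : R.
Hypothesis half_h : 2%:R * h = 1.
Hypothesis proper_A : forall f : {linear A -> A}, commuting f -> proper_map f.
Hypothesis proper_B : forall f : {linear B -> B}, commuting f -> proper_map f.

Variable Q : G -> G -> G.
Hypothesis Q_lin : forall k x x' y, Q (k *: x + x') y = k *: Q x y + Q x' y.
Hypothesis QC : forall x y, Q x y = Q y x.
Hypothesis Q_cyc : forall x y z,
  lie_bracket (Q x y) z + lie_bracket (Q y z) x + lie_bracket (Q z x) y = 0.
Hypothesis Q_diag : forall x, lie_bracket (Q x x) x = 0.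

Lemma halve (V : lmodType R) (v w : V) : v + v = w -> v = h *: w.
Proof. by move=> <-; rewrite -mulr2n -scaler_nat scalerA mulrC half_h scale1r. Qed.

Notation e := (inA 1 : G).
Let S x := Q x e.

Let S_lin k x x' : S (k *: x + x') = k *: S x + S x'.
Proof. exact: Q_lin. Qed.

Let cycA x y z : piA (lie_bracket (Q x y) z) + piA (lie_bracket (Q y z) x)
  + piA (lie_bracket (Q z x) y) = 0.
Proof. exact: etrans (congr1 (@piA _ _) (Q_cyc x y z)) _. Qed.

Let cycM x y z : gmaM (lie_bracket (Q x y) z) + gmaM (lie_bracket (Q y z) x)
  + gmaM (lie_bracket (Q z x) y) = 0.
Proof. exact: etrans (congr1 (@gmaM _ _) (Q_cyc x y z)) _. Qed.

Let cycN x y z : gmaN (lie_bracket (Q x y) z) + gmaN (lie_bracket (Q y z) x)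
  + gmaN (lie_bracket (Q z x) y) = 0.
Proof. exact: etrans (congr1 (@gmaN _ _) (Q_cyc x y z)) _. Qed.

Let cycB x y z : piB (lie_bracket (Q x y) z) + piB (lie_bracket (Q y z) x)
  + piB (lie_bracket (Q z x) y) = 0.
Proof. exact: etrans (congr1 (@piB _ _) (Q_cyc x y z)) _. Qed.

Let S_e_M : gmaM (S e) = 0.
Proof.
have := congr1 (@gmaM _ _) (Q_diag e).
rewrite gmaM_bracket !entryE !(act0, lact1, subr0, oppr0, sub0r) => E.
by apply: oppr_inj; rewrite oppr0; exact: E.
Qed.

Let S_e_N : gmaN (S e) = 0.
Proof.
have := congr1 (@gmaN _ _) (Q_diag e).
by rewrite gmaN_bracket !entryE !(act0, ract1, subr0, oppr0, sub0r, opprK).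
Qed.

Let S_e_A : alg_center A (piA (S e)).
Proof.
apply/centerP => a; have := cycA (inA a) e e.
rewrite !piA_bracket !entryE !act0 !bracketx1 -/(S _).
by rewrite !(oppr0, subr0, addr0, add0r).
Qed.

Let S_e_B : alg_center B (piB (S e)).
Proof.
apply/centerP => b; have := cycB (inB b) e e.
rewrite !piB_bracket !entryE !act0 !bracketx0 -/(S _).
by rewrite !(oppr0, subr0, addr0, add0r).
Qed.

(** The cyclic identity at (x, e, e) reads 2 [S(x), e] = - [S(e), x]. Here S(e) is diagonal with
    central entries, lifted to z and z', whence g = (z - z') / 2. *)
Let S_offdiag : exists2 g, alg_center G g & forall x,
  gmaM (S x) = lact M (piA g) (gmaM x) /\ gmaN (S x) = lact N (piB g) (gmaN x).
Proof.
have [z cz zA] := lift_piA S_e_A; have [z' cz' zB] := lift_piB S_e_B.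
exists (h *: (z - z')); first by apply/centerZ/centerB.
move=> x; rewrite !gma_linE !actZ; split; apply: halve.
  have := cycM x e e.
  rewrite !gmaM_bracket !entryE !act0 !lact1 (QC e) -/(S x) -/(S _).
  rewrite S_e_M -zA -zB !act0 -center_lactM // !actE => E.
  by rewrite -[LHS]addr0 -E; zmod.
have := cycN x e e.
rewrite !gmaN_bracket !entryE !act0 !ract1 (QC e) -/(S x) -/(S _).
rewrite S_e_N -zA -zB !act0 -center_lactN // !actE => E.
by rewrite -[LHS]subr0 -E; zmod.
Qed.

(** At (a, a, e) the bracket with e has no A-entry, so a -> [piA (S (inA a))] is commuting, hence
    proper. The part y of x outside A contributes a central term, by the identity at (y, a, e). *)
Let S_A : exists2 z, alg_center G z &
  forall x, alg_center A (piA (S x) - piA z * piA x).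
Proof.
have [g cg Sg] := S_offdiag.
have [|f fE] := @linear_pack R A A (fun a => piA (S (inA a))).
  move=> k a a'; have -> : inA (k *: a + a') = k *: inA a + inA a'.
    by apply: gma_eq; rewrite !gma_linE !entryE ?scaler0 ?addr0.
  by rewrite S_lin !gma_linE.
have [|a0 [eta [ca0 ceta f_eta]]] := proper_A (f := f).
  move=> a; have := cycA (inA a) (inA a) e.
  rewrite !piA_bracket !entryE !act0 bracketx1 (QC e) -/(S _).
  rewrite subrr !addr0 add0r fE => /halve ->.
  by rewrite scaler0.
have [z cz zA] := lift_piA ca0; exists z => // x.
have S0 y : piA y = 0 -> alg_center A (piA (S y)).
  move=> yA; apply/centerP => a; have := cycA y (inA a) e.
  rewrite !piA_bracket !entryE !act0 bracketx1 (QC e) -/(S _) -/(S _).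
  rewrite !(Sg _).1 !(Sg _).2.
  by rewrite !entryE !act0 yA bracketx0 subrr !addr0 !add0r.
have SD y y' : S (y + y') = S y + S y' by rewrite -[y]scale1r S_lin !scale1r.
pose y := x - inA (piA x).
have xE : piA (S x) = a0 * piA x + eta (piA x) + piA (S y).
  by rewrite -f_eta fE -[x in LHS](subrK (inA (piA x))) SD addrC.
have -> : piA (S x) - piA z * piA x = eta (piA x) + piA (S y).
  by rewrite xE zA; zmod.
by apply: centerD => //; apply: S0; rewrite !gma_linE !entryE subrr.
Qed.

Let S_B : exists2 z, alg_center G z &
  forall x, alg_center B (piB (S x) - piB z * piB x).
Proof.
have [g cg Sg] := S_offdiag.
have [|f fE] := @linear_pack R B B (fun b => piB (S (inB b))).
  move=> k b b'; have -> : inB (k *: b + b') = k *: inB b + inB b'.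
    by apply: gma_eq; rewrite !gma_linE !entryE ?scaler0 ?addr0.
  by rewrite S_lin !gma_linE.
have [|b0 [eta [cb0 ceta f_eta]]] := proper_B (f := f).
  move=> b; have := cycB (inB b) (inB b) e.
  rewrite !piB_bracket !entryE !act0 bracketx0 (QC e) -/(S _).
  rewrite subrr !addr0 add0r fE => /halve ->.
  by rewrite scaler0.
have [z cz zB] := lift_piB cb0; exists z => // x.
have S0 y : piB y = 0 -> alg_center B (piB (S y)).
  move=> yB; apply/centerP => b; have := cycB y (inB b) e.
  rewrite !piB_bracket !entryE !act0 bracketx0 (QC e) -/(S _) -/(S _).
  rewrite !(Sg _).1 !(Sg _).2.
  by rewrite !entryE !act0 yB bracketx0 subrr !addr0 !add0r.
have SD y y' : S (y + y') = S y + S y' by rewrite -[y]scale1r S_lin !scale1r.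
pose y := x - inB (piB x).
have xE : piB (S x) = b0 * piB x + eta (piB x) + piB (S y).
  by rewrite -f_eta fE -[x in LHS](subrK (inB (piB x))) SD addrC.
have -> : piB (S x) - piB z * piB x = eta (piB x) + piB (S y).
  by rewrite xE zB; zmod.
by apply: centerD => //; apply: S0; rewrite !gma_linE !entryE subrr.
Qed.

(** The central error term is lifted to the center of G; the lift is linear because it is unique. *)
Let S_AE : exists z (r : {linear G -> G}), [/\ alg_center G z,
  forall x, alg_center G (r x) & forall x, piA (S x) = piA (r x) + piA z * piA x].
Proof.
have [z cz zS] := S_A; exists z.
have /choice[r rP] x : exists w, alg_center G w /\
    piA w = piA (S x) - piA z * piA x.
  by have [w cw <-] := lift_piA (zS x); exists w.
have [|f fE] := @linear_pack R G G r.
  move=> k x y; apply: center_piA_inj; first by have [] := rP (k *: x + y).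
    by apply: centerD; [apply: centerZ|]; have [] := rP x; have [] := rP y.
  rewrite (rP _).2 !gma_linE !(rP _).2 S_lin !gma_linE.
  by rewrite mulrDr scalerBr scalerAr; zmod.
by exists f; split=> // x; have [cr rE] := rP x; rewrite fE // rE subrK.
Qed.

Let S_BE : exists z (s : {linear G -> G}), [/\ alg_center G z,
  forall x, alg_center G (s x) & forall x, piB (S x) = piB (s x) + piB z * piB x].
Proof.
have [z cz zS] := S_B; exists z.
have /choice[r rP] x : exists w, alg_center G w /\
    piB w = piB (S x) - piB z * piB x.
  by have [w cw <-] := lift_piB (zS x); exists w.
have [|f fE] := @linear_pack R G G r.
  move=> k x y; apply: center_piB_inj; first by have [] := rP (k *: x + y).
    by apply: centerD; [apply: centerZ|]; have [] := rP x; have [] := rP y.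
  rewrite (rP _).2 !gma_linE !(rP _).2 S_lin !gma_linE.
  by rewrite mulrDr scalerBr scalerAr; zmod.
by exists f; split=> // x; have [cr rE] := rP x; rewrite fE // rE subrK.
Qed.

Lemma commuting_trace : exists lam (kap : {linear G -> G}),
  [/\ alg_center G lam, forall x, alg_center G (kap x) &
    forall x y, alg_center G
      (Q x y - (lam * (x * y + y * x) + kap x * y + kap y * x))].
Proof.
have [g cg Sg] := S_offdiag.
have [al [r [cal cr SA]]] := S_AE; have [be [s [cbe cs SB]]] := S_BE.
(* The cyclic identity at (x, y, e) shows that Q(x, y) and [S(x), y] + [S(y), x] have equal
   M-entries. There [al - g] is the coefficient of [piA x] times [gmaM y], and [r x - s x] is that
   of [gmaM y] alone. *)
pose lam : G := al - g.
have clam : alg_center G lam by apply: centerB.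
have [|kap kapE] := @linear_pack R G G (fun x => r x - s x).
  by move=> k x y; rewrite !linearP /= !scalerDr !scalerN; zmod.
have ckap x : alg_center G (kap x) by rewrite kapE; apply: centerB.
exists lam, kap; split=> //.
pose P x y : G := lam * (x * y + y * x) + kap x * y + kap y * x.
pose Q' x y : G := Q x y - P x y.
have Q'D x x' y : Q' (x + x') y = Q' x y + Q' x' y.
  rewrite /Q' /P -[x in LHS]scale1r Q_lin !scale1r (linearD kap).
  by rewrite !(mulrDl, mulrDr); zmod.
have Q'C x y : Q' x y = Q' y x by rewrite /Q' /P QC !mulrDr; zmod.
have Q'_cyc x y z :
  lie_bracket (Q' x y) z + lie_bracket (Q' y z) x + lie_bracket (Q' z x) y = 0.
  rewrite !bracketDl !bracketNl !bracketDl.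
  rewrite !(bracketMl _ _ clam, bracketMl _ _ (ckap _)).
  rewrite (lie_bracketC z y) (lie_bracketC y x) (lie_bracketC x z) !mulrN.
  have lam0 : lam * lie_bracket (x * y + y * x) z +
      lam * lie_bracket (y * z + z * y) x +
      lam * lie_bracket (z * x + x * z) y = 0.
    by rewrite -!mulrDr jordan_cyc mulr0.
  by rewrite -[RHS](subrr 0) -{1}(Q_cyc x y z) -lam0; zmod.
(* In the same expansion [gmaM x] times [piB y] has coefficient [g - be]; [th] is its excess over
   [lam]. *)
pose th : G := g + g - al - be.
have cth : alg_center G th by do 2![apply: centerB => //]; apply: centerD.
have Q'M x y : gmaM (Q' x y) =
    lact M (piA th) (ract M (gmaM x) (piB y) + ract M (gmaM y) (piB x)).
  have E := cycM x y e.
  rewrite !gmaM_bracket !entryE !act0 !lact1 (QC e) -/(S _) -/(S _) in E.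
  rewrite !(Sg _).1 !SA !SB !actE -!lactA -!ractA in E.
  rewrite -!(center_lactM _ (cs _)) -!(center_lactM _ cbe) !lractA in E.
  rewrite (lactA (piA x)) (lactA (piA y)) -!(center_piA cg) -!lactA in E.
  rewrite /Q' /P !gma_linE !gma_mulE !kapE !(center_gmaM clam).
  rewrite !(center_gmaM (centerB (cr _) (cs _))) !gma_linE !act0 !addr0 !actE.
  by rewrite -[LHS]addr0 -E; zmod.
have Q'N x y : gmaN (Q' x y) =
    lact N (piB th) (lact N (piB y) (gmaN x) + lact N (piB x) (gmaN y)).
  have E := cycN x y e.
  rewrite !gmaN_bracket !entryE !act0 !ract1 (QC e) -/(S _) -/(S _) in E.
  rewrite !(Sg _).2 !SA !SB !actE -!lactA -!ractA in E.
  rewrite -!(center_lactN _ (cr _)) -!(center_lactN _ cal) !lractA in E.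
  rewrite (lactA (piB x)) (lactA (piB y)) -!(center_piB cg) -!lactA in E.
  rewrite /Q' /P !gma_linE !gma_mulE !kapE !(center_gmaN clam).
  rewrite !(center_gmaN (centerB (cr _) (cs _))) !gma_linE !act0 !add0r !actE.
  by rewrite -[LHS]subr0 -E; zmod.
have th0 := trace_coef_eq0 Q'_cyc cth Q'M.
by apply: (diagonal_trace_center Q'D Q'C Q'_cyc) => x y; rewrite ?Q'M ?Q'N th0 !act0.
Qed.

End CommutingTrace.

(** The M-entry of a central element is 0. At (e, a, m) this gives c a = - g1(e, a), so c a is
    central for every a and c kills commutators of A. With c = 0, taking u and w in M gives an
    exchange identity; then w in M and u in M dispose of g1 and g2. *)
Lemma central_bilinear_eq0 c (g1 g2 : G -> G -> G) : alg_center G c ->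
  (forall u v, alg_center G (g1 u v)) -> (forall u v, alg_center G (g2 u v)) ->
  (forall u v w, alg_center G
     (c * lie_bracket v (lie_bracket u w) + g1 u v * w + g2 v w * u)) ->
  [/\ c = 0, forall u v, g1 u v = 0 & forall u v, g2 u v = 0].
Proof.
move=> cc cg1 cg2 cgg.
have gmaMc z x : alg_center G z -> gmaM (z * x) = lact M (piA z) (gmaM x).
  by move=> cz; rewrite gmaM_mul (center_gmaM cz) act0 addr0.
have H u v w : lact M (piA c) (gmaM (lie_bracket v (lie_bracket u w))) +
    lact M (piA (g1 u v)) (gmaM w) + lact M (piA (g2 v w)) (gmaM u) = 0.
  by rewrite -!gmaMc //; exact: (center_gmaM (cgg u v w)).
have c0 : c = 0.
  have cA a : alg_center A (piA c * a).
    suff -> : piA c * a = - piA (g1 (inA 1) (inA a)).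
      exact/centerN/center_piA.
    apply/eqP; rewrite -addr_eq0; apply/eqP/faithful_l => m.
    have := H (inA 1) (inA a) (inM m).
    by rewrite !gmaM_bracket !entryE !act0 lact1 !subr0 addr0 lactA actE.
  apply: center_mul_commutator_eq0 => // a a'.
  rewrite mulrBr mulrA cA (mulrA _ a') (center_piA cc a').
  by rewrite -[in X in _ - X]mulrA subrr.
have g2M v m : g2 v (inM m) = 0.
  apply: center_piA_inj => //; first exact: center0.
  move: m; apply: (@swap_eq0_A _ (fun m => piA (g1 (inM m) v))) => m m'.
  by have := H (inM m') v (inM m); rewrite c0 gma_linE !entryE act0 add0r addrC.
have g10 u v : g1 u v = 0.
  apply: center_piA_inj => //; first exact: center0.
  apply: faithful_l => m; have := H u v (inM m).
  by rewrite c0 g2M !gma_linE !entryE !act0 add0r addr0.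
split=> // v w; apply: center_piA_inj => //; first exact: center0.
apply: faithful_l => m; have := H (inM m) v w.
by rewrite c0 g10 !gma_linE !entryE !act0 !add0r.
Qed.

End LoyalGMA.

(** * Lie isomorphisms *)

Section LieIsomorphism.
Variables (R : comNzRingType) (C0 C : moritaContext R).
Notation G0 := (gma C0).
Notation G := (gma C).
Hypothesis faithful_l0 : left_faithful (mcM C0).
Hypothesis faithful_r0 : right_faithful (mcM C0).
Hypothesis faithful_l : left_faithful (mcM C).
Hypothesis faithful_r : right_faithful (mcM C).
Hypothesis center_A : @piA _ C @` alg_center G = alg_center (mcA C).
Hypothesis center_B : @piB _ C @` alg_center G = alg_center (mcB C).
Hypothesis ncA : exists a a' : mcA C, a * a' - a' * a != 0.
Hypothesis ncB : exists b b' : mcB C, b * b' - b' * b != 0.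
Hypothesis loyal_M : loyal (mcM C).
Variable h : R.
Hypothesis half_h : 2%:R * h = 1.
Hypothesis proper_A :
  forall f : {linear mcA C -> mcA C}, commuting f -> proper_map f.
Hypothesis proper_B :
  forall f : {linear mcB C -> mcB C}, commuting f -> proper_map f.

Variables (l : {linear G0 -> G}) (l' : G -> G0).
Hypothesis lK : cancel l l'.
Hypothesis l'K : cancel l' l.
Hypothesis l_br : forall x y, l (lie_bracket x y) = lie_bracket (l x) (l y).

(** Brackets with Q are images under [l] of brackets with Jordan products, so Q satisfies the
    conditions of [commuting_trace]. *)
Lemma lie_jordan : exists lam (k : {linear G0 -> G}),
  [/\ alg_center G lam, forall x, alg_center G (k x) &
    forall x y, alg_center G (l (x * y + y * x)
      - (lam * (l x * l y + l y * l x) + k x * l y + k y * l x))].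
Proof.
pose Q u v : G := l (l' u * l' v + l' v * l' u).
have l'_lin c u v : l' (c *: u + v) = c *: l' u + l' v.
  by apply: (can_inj lK); rewrite linearP !l'K.
have Q_lin c u u' v : Q (c *: u + u') v = c *: Q u v + Q u' v.
  rewrite /Q -linearP l'_lin; congr (l _).
  by rewrite mulrDl mulrDr -scalerAl -scalerAr scalerDr; zmod.
have QC u v : Q u v = Q v u by rewrite /Q addrC.
have Q_br u v w : lie_bracket (Q u v) w =
    l (lie_bracket (l' u * l' v + l' v * l' u) (l' w)).
  by rewrite l_br l'K.
have Q_cyc u v w :
  lie_bracket (Q u v) w + lie_bracket (Q v w) u + lie_bracket (Q w u) v = 0.
  by rewrite !Q_br -!linearD jordan_cyc linear0.
have Q_diag u : lie_bracket (Q u u) u = 0.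
  rewrite Q_br (_ : lie_bracket _ _ = 0) ?linear0 //.
  by rewrite /lie_bracket mulrDl mulrDr !mulrA subrr.
have [lam [kap [clam ckap kapE]]] := commuting_trace faithful_l faithful_r
  center_A center_B ncA ncB loyal_M half_h proper_A proper_B Q_lin QC Q_cyc Q_diag.
have [|k kE] := @linear_pack R G0 G (fun x => kap (l x)).
  by move=> c x y; rewrite !linearP.
exists lam, k; split=> [//|x|x y]; first by rewrite kE.
by have := kapE (l x) (l y); rewrite /Q !lK !kE.
Qed.

Lemma lie_jordan_coef lam (k : {linear G0 -> G}) : alg_center G lam ->
  (forall x, alg_center G (k x)) ->
  (forall x y, alg_center G (l (x * y + y * x)
      - (lam * (l x * l y + l y * l x) + k x * l y + k y * l x))) ->
  lam * lam = 1.
Proof.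
move=> clam ck cnu.
pose nu x y : G := l (jor x y) - (lam * jor (l x) (l y) + k x * l y + k y * l x).
have {}cnu x y : alg_center G (nu x y) := cnu x y.
have lE x y :
    l (jor x y) = lam * jor (l x) (l y) + k x * l y + k y * l x + nu x y.
  by rewrite /nu; zmod.
clearbody nu.
(* [g x y] collects the central coefficient of [l z] when [jor_associator], in both algebras, is
   expanded by [lE]. *)
pose g x y := lam * (nu x y + nu x y) + k (jor x y) - k x * k y.
have cg x y : alg_center G (g x y).
  apply: centerB; last exact: centerM.
  by apply: centerD => //; apply: centerM => //; apply: centerD.
have key x y z : (lam * lam - 1) * lie_bracket (l y) (lie_bracket (l x) (l z))
    + g x y * l z - g y z * l x
    = k x * nu y z - k z * nu x y + nu (jor y z) x - nu (jor x y) z.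
  have E : l (jor (jor x y) z) - l (jor (jor y z) x) =
      lie_bracket (l y) (lie_bracket (l x) (l z)).
    by rewrite -linearB jor_associator !l_br.
  rewrite !lE !jorDl !(jorMl _ _ clam) !(jorMl _ _ (ck _)) in E.
  rewrite (jor_center (l z) (cnu x y)) (jor_center (l x) (cnu y z)) in E.
  rewrite (jorC (l z) (l x)) (jorC (l y) (l x)) in E.
  rewrite mulrBl mul1r -{2}E -jor_associator /g.
  move: (jor (jor (l x) (l y)) (l z)) (jor (jor (l y) (l z)) (l x))
    (jor (l x) (l y)) (jor (l y) (l z)) (jor (l x) (l z)) {E} => j1 j2 a b c.
  rewrite !(mulrDl, mulrDr, mulrN, mulNr) !mulrA.
  by rewrite !(clam (k _)) (ck z (k x)) (ck z (k y)); zmod.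
have [] := central_bilinear_eq0 faithful_l faithful_r ncA ncB loyal_M
  (c := lam * lam - 1) (g1 := fun u v => g (l' u) (l' v))
  (g2 := fun u v => - g (l' u) (l' v)).
- exact/centerB/center1/centerM.
- by [].
- by move=> u v; apply/centerN.
- move=> u v w; have := key (l' u) (l' v) (l' w); rewrite !l'K mulNr => ->.
  by do 2![apply: centerB => //; try apply: centerD => //]; apply: centerM.
by move=> /eqP; rewrite subr_eq0 => /eqP.
Qed.

(** Replacing [m] by [l] changes the cocycle expression by central terms only; as [l] is onto,
    [central_bilinear_eq0] applies with c = 0. *)
Lemma central_cocycle_eq0 (m s : {linear G0 -> G}) (d : G0 -> G0 -> G) :
  (forall x, m x = l x + s x) -> (forall x, alg_center G (s x)) ->
  (forall x y, alg_center G (d x y)) ->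
  (forall x y z, alg_center G (d x y * m z - d y z * m x)) ->
  forall x y, d x y = 0.
Proof.
move=> mE cs cd cdm x y.
have [] := central_bilinear_eq0 faithful_l faithful_r ncA ncB loyal_M
  (c := 0) (g1 := fun u v => d (l' u) (l' v)) (g2 := fun u v => - d (l' u) (l' v)).
- exact: center0.
- by [].
- by move=> u v; apply: centerN.
- move=> u v w; have := cdm (l' u) (l' v) (l' w); rewrite !mE !l'K => cE.
  rewrite mul0r add0r mulNr.
  have -> : d (l' u) (l' v) * w - d (l' v) (l' w) * u =
      d (l' u) (l' v) * (w + s (l' w)) - d (l' v) (l' w) * (u + s (l' u))
      - (d (l' u) (l' v) * s (l' w) - d (l' v) (l' w) * s (l' u)).
    by rewrite !mulrDr; zmod.
  by apply: centerB => //; apply: centerB; apply: centerM.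
by move=> _ /(_ (l x) (l y)); rewrite !lK.
Qed.

Lemma lie_isomorphism_split : exists m s : {linear G0 -> G},
  [/\ forall x, m x = l x + s x, forall x, alg_center G (s x) &
    homomorphism m \/ forall x y, m (x * y) = - (m y * m x)].
Proof.
have [lam [k [clam ck cnu]]] := lie_jordan.
have lam2 := lie_jordan_coef clam ck cnu.
(* With [s] = lam k / 2 the linear terms complete the product of [l x + s x] and [l y + s y]. *)
have [|s sE] := @linear_pack R G0 G (fun x => h *: (lam * k x)).
  move=> c x y; rewrite linearP /= mulrDr scalerDr -scalerAr !scalerA.
  by rewrite (mulrC h).
have cs x : alg_center G (s x) by rewrite sE; apply/centerZ/centerM.
have [|m mE] := @linear_pack R G0 G (fun x => l x + s x).
  by move=> c x y; rewrite !linearP scalerDr; zmod.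
exists m, s; split=> //.
have half2 (v : G) : h *: v + h *: v = v.
  by rewrite -mulr2n -scaler_nat scalerA half_h scale1r.
have kE x : k x = lam * (s x + s x).
  by rewrite sE half2 mulrA lam2 mul1r.
pose nu x y : G := l (x * y + y * x)
  - (lam * (l x * l y + l y * l x) + k x * l y + k y * l x).
have {}cnu x y : alg_center G (nu x y) := cnu x y.
have jE x y : l (x * y) + l (y * x) =
    lam * (l x * l y + l y * l x) + k x * l y + k y * l x + nu x y.
  by rewrite -linearD /nu; zmod.
clearbody nu.
have bE x y : l (x * y) - l (y * x) = l x * l y - l y * l x.
  by rewrite -linearB; exact: l_br.
have lE x y : l (x * y) + l (x * y) = lam * (l x * l y + l y * l x)
    + k x * l y + k y * l x + nu x y + (l x * l y - l y * l x).
  by rewrite -jE -bE; zmod.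
have dbl (v w : G) : v + v = w + w -> v = w.
  by move=> vw; rewrite -[v]half2 -[w]half2 -!scalerDr vw.
have : (lam - 1) * (lam + 1) = 0.
  by rewrite mulrDr mulr1 mulrBl mul1r lam2; zmod.
have cl1 := centerB clam (@center1 R G).
case/(center_domain faithful_l faithful_r loyal_M cl1 (centerD clam (@center1 R G))).
  move=> /eqP; rewrite subr_eq0 => /eqP lam1; left.
  pose d x y : G := h *: nu x y + s (x * y) - s x * s y.
  have cd x y : alg_center G (d x y).
    by apply: centerB; [apply: centerD => //; apply: centerZ|apply: centerM].
  have md x y : m (x * y) = m x * m y + d x y.
    apply: dbl; rewrite !mE addrACA lE /d !kE lam1 !mul1r.
    by rewrite -{1}(half2 (nu x y)) !(mulrDl, mulrDr) (cs y); zmod.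
  clearbody d.
  have d0 : forall x y, d x y = 0.
    apply: (central_cocycle_eq0 mE cs cd) => x y z.
    (* Associativity: expand [m] of (x y) z = x (y z) in both ways. *)
    have -> : d x y * m z - d y z * m x = d x (y * z) - d (x * y) z.
      have := congr1 m (mulrA x y z).
      rewrite !md !(mulrDl, mulrDr) !mulrA -(cd y z) => /eqP.
      rewrite -subr_eq0 => /eqP E.
      by rewrite -[RHS]subr0 -E; zmod.
    exact: centerB.
  by move=> x y; rewrite md d0 addr0.
move=> /eqP; rewrite addr_eq0 => /eqP lam1; right.
pose d x y : G := h *: nu x y + s (x * y) + s x * s y.
have cd x y : alg_center G (d x y).
  by apply: centerD; [apply: centerD => //; apply: centerZ|apply: centerM].
have md x y : m (x * y) = - (m y * m x) + d x y.
  apply: dbl; rewrite !mE addrACA lE /d !kE lam1 !mulNr !mul1r.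
  rewrite -{1}(half2 (nu x y)) !(mulrDl, mulrDr, mulNr).
  by rewrite -(cs x) (cs y (s x)); zmod.
clearbody d.
have d0 : forall x y, d x y = 0.
  apply: (central_cocycle_eq0 mE cs cd) => x y z.
  have -> : d x y * m z - d y z * m x = d (x * y) z - d x (y * z).
    have := congr1 m (mulrA x y z).
    rewrite !md !(mulrDl, mulrDr, mulrN, mulNr) !mulrA -(cd x y) => /eqP.
    rewrite -subr_eq0 => /eqP E.
    by rewrite -[RHS]addr0 -E; zmod.
  exact: centerB.
by move=> x y; rewrite md d0 addr0.
Qed.

(** If m x = 0 then l x is central, hence so is x. The kernel is thus an ideal of central elements;
    multiplying z in it by [inM w] gives a central element, whose M-entry 0 is [piA z] or [piB z]
    applied to w. *)
Lemma split_inj (m s : {linear G0 -> G}) :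
  (forall x, m x = l x + s x) -> (forall x, alg_center G (s x)) ->
  homomorphism m \/ (forall x y, m (x * y) = - (m y * m x)) -> injective m.
Proof.
move=> mE cs hom.
have mul0 x y : m x = 0 -> m (x * y) = 0 /\ m (y * x) = 0.
  by move=> mx0; case: hom => mM; rewrite !mM mx0 mul0r mulr0 ?oppr0.
have ker_center x : m x = 0 -> alg_center G0 x.
  move=> mx0; have lx : l x = - s x by apply/eqP; rewrite -addr_eq0 -mE mx0.
  apply/centerP => y; apply: (can_inj lK).
  by rewrite l_br linear0 lx (proj1 (centerP _) (centerN (cs x))).
move=> x y mxy; apply/eqP; rewrite -subr_eq0; apply/eqP.
set z := x - y; have mz : m z = 0 by rewrite linearB mxy subrr.
have cz := ker_center _ mz; apply: gma_eq.
- apply: faithful_l0 => w; have [/ker_center/center_gmaM + _] := mul0 z (inM w) mz.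
  by rewrite gma_mulE !entryE !act0 addr0.
- by rewrite center_gmaM.
- by rewrite center_gmaN.
- apply: faithful_r0 => w; have [_ /ker_center/center_gmaM] := mul0 z (inM w) mz.
  by rewrite gma_mulE !entryE !act0 add0r.
Qed.

(** The shift [s] takes values in R1, so it suffices that [m] attains 1. *)
Lemma split_surj (m s : {linear G0 -> G}) :
  (forall x, m x = l x + s x) -> (forall x, alg_center G (s x)) ->
  homomorphism m \/ (forall x y, m (x * y) = - (m y * m x)) ->
  central_algebra G -> forall y, exists x, m x = y.
Proof.
move=> mE cs hom cG y; have m_inj := split_inj mE cs hom.
have cl1 : alg_center G (l 1).
  apply/centerP => u; rewrite -(l'K u) -l_br -(linear0 l); congr (l _).
  by apply/bracket0P; rewrite mul1r mulr1.
have cm1 : alg_center G (m 1) by rewrite mE; apply: centerD.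
have m1_neq0 : m 1 <> 0 by rewrite -(linear0 m) => /m_inj/eqP; rewrite oner_eq0.
(* Up to sign, [m 1] is a nonzero idempotent of a domain, so it is 1 or -1; c is that sign. *)
have [c m1] : exists c : R, m (c *: 1) = 1.
  case: hom => mM.
    exists 1; rewrite scale1r; have := mM 1 1; rewrite mulr1 => m11.
    have : m 1 * (m 1 - 1) = 0 by rewrite mulrBr mulr1 -m11 subrr.
    case/(center_domain faithful_l faithful_r loyal_M cm1 (centerB cm1 (@center1 _ _))) => //.
    by move=> /eqP; rewrite subr_eq0 => /eqP.
  exists (- 1); rewrite linearZ /= scaleN1r; have := mM 1 1; rewrite mulr1 => m11.
  have : m 1 * (m 1 + 1) = 0 by rewrite mulrDr mulr1 [X in _ + X]m11 subrr.
  case/(center_domain faithful_l faithful_r loyal_M cm1 (centerD cm1 (@center1 _ _))) => //.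
  by move=> /eqP; rewrite addr_eq0 => /eqP ->; rewrite opprK.
have [k _ sk] : range (fun k : R => k%:A : G) (s (l' y)).
  by rewrite -cG; apply: cs.
exists (l' y - (k * c) *: 1).
by rewrite linearB -scalerA linearZ /= m1 sk mE l'K addrK.
Qed.

End LieIsomorphism.

Lemma noncentral_commutator (R : comNzRingType) (A : algType R) :
  alg_center A <> [set: A] -> exists a a' : A, a * a' - a' * a != 0.
Proof.
move=> ncA; apply: contrapT => comm; apply: ncA.
apply/seteqP; split=> // a _ a'; apply/eqP; rewrite -subr_eq0.
by apply/negP => /negP aa'; apply: comm; exists a, a'.
Qed.

Theorem theorem4p3
  (R : comNzRingType) (half : exists h : R, 2%:R * h = 1)
  (C C' : moritaContext R)
  (nzC : nonzero_bimodules C) (nzC' : nonzero_bimodules C')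
  (faithful_l : left_faithful (mcM C)) (faithful_r : right_faithful (mcM C))
  (faithful_l' : left_faithful (mcM C')) (faithful_r' : right_faithful (mcM C'))
  (l : {linear gma C -> gma C'}) (l_lie : lie_isomorphism l)
  (proper_A' : forall f : {linear mcA C' -> mcA C'},
     commuting f -> proper_map f)
  (proper_B' : forall f : {linear mcB C' -> mcB C'},
     commuting f -> proper_map f)
  (center_A' : @piA _ C' @` alg_center (gma C') = alg_center (mcA C'))
  (center_A'_neq : alg_center (mcA C') <> [set: mcA C'])
  (center_B' : @piB _ C' @` alg_center (gma C') = alg_center (mcB C'))
  (center_B'_neq : alg_center (mcB C') <> [set: mcB C'])
  (noncomm : ~ commutative (@GRing.mul (mcA C)) \/
             ~ commutative (@GRing.mul (mcB C)))
  (loyal_M' : loyal (mcM C')) :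
  exists m n : {linear gma C -> gma C'},
    [/\ forall x, l x = m x + n x,
        homomorphism m \/ neg_antihomomorphism m,
        injective m,
        (forall x, alg_center (gma C') (n x)) /\
        (forall x y, n (lie_bracket x y) = 0)
      & central_algebra (gma C') -> forall y, exists x, m x = y].
Proof.
case: half => h half_h; case: l_lie => [[l' lK l'K] l_br].
have ncA := noncentral_commutator center_A'_neq.
have ncB := noncentral_commutator center_B'_neq.
have [m [s [mE cs hom]]] := lie_isomorphism_split faithful_l' faithful_r'
  center_A' center_B' ncA ncB loyal_M' half_h proper_A' proper_B' lK l'K l_br.
have [|n nE] := @linear_pack R _ _ (fun x => - s x).
  by move=> k x y; rewrite linearP opprD scalerN.
have m_br x y : m (lie_bracket x y) = lie_bracket (m x) (m y).
  rewrite /lie_bracket linearB.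
  by case: hom => mM; rewrite !mM ?opprK // addrC.
exists m, n; split.
- by move=> x; rewrite nE mE addrK.
- case: hom => mM; [by left|right].
  have [|g gE] := @linear_pack R _ _ (fun x => - m x).
    by move=> k x y; rewrite linearP opprD scalerN.
  by exists g; split=> [x y|x]; rewrite !gE ?opprK // mM opprK mulrNN.
- exact: (split_inj faithful_l faithful_r lK l_br mE cs hom).
- split=> [x|x y]; first by rewrite nE; apply: centerN.
  (* As [m] preserves brackets and differs from [l] by central values, [m x, m y] = [l x, l y],
     which leaves nothing for [s]. *)
  rewrite nE; have := mE (lie_bracket x y); rewrite m_br l_br => E.
  rewrite -[s _](addKr (lie_bracket (l x) (l y))) -E !mE.
  rewrite bracketDl ((centerP _).1 (cs x)) addr0 [lie_bracket _ (_ + _)]lie_bracketC.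
  rewrite bracketDl ((centerP _).1 (cs y)) addr0 -lie_bracketC.
  by rewrite addNr oppr0.
- exact: (split_surj faithful_l faithful_r faithful_l' faithful_r' loyal_M'
    lK l'K l_br mE cs hom).
Qed.
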